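(* Let $\kappa=(k_x)_{x\in\Sigma}$ be a partition with $|\kappa|=k$, let $r\in\{0,\dots,k-k_{\mathtt a}\}$, and let $f\in W_{\kappa r}$ be nonzero. Suppose that $\mathbf n=(n_x)_{x\in\Sigma}$ varies so that $n=|\mathbf n|\to\infty$ and $n_x/n\to p_x>0$ for every $x\in\Sigma$. Then there exists $C'_{f,\mathbf p}>0$ such that $$ n^r\,\mathbb{E}_{w\sim\mathcal{W}'(\mathbf n)}\left[\left(\tilde\# f(w)\right)^2\right]\;\xrightarrow[n\to\infty]{}\;C'_{f,\mathbf p} . $$ Moreover, for every $r'\in\{0,\dots,k-k_{\mathtt a}\}$ with $r'\ne r$ and every $f'\in W_{\kappa r'}$, $$ \mathbb{E}_{w\sim\mathcal{W}'(\mathbf n)}\left[\left(n^{r/2}\,\tilde\# f(w)\right)\left(n^{r'/2}\,\tilde\# f'(w)\right)\right]\;\xrightarrow[n\to\infty]{}\;0 . $$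
   Context: $\Sigma=\{\mathtt a<\mathtt b<\mathtt c<\cdots\}$ is a finite ordered alphabet, $|\Sigma|\ge2$. For $\mathbf n=(n_x)_{x\in\Sigma}$ of nonnegative integers, $|\mathbf n|=\sum_x n_x$, and $\binom{\Sigma}{\mathbf n}$ is the set of words in which each letter $x$ occurs exactly $n_x$ times; such words have composition $\mathbf n$. $\mathcal W'(\mathbf n)$ is the uniform distribution on $\binom{\Sigma}{\mathbf n}$. $\#u(w)$ is the number of occurrences of the word $u$ as a (not necessarily contiguous) subsequence of $w$, counted by position sets. $\kappa=(k_{\mathtt a},k_{\mathtt b},\dots)$ is assumed to satisfy $k_{\mathtt a}\ge k_{\mathtt b}\ge\dots>0$. $W_\kappa=\mathbb R\binom{\Sigma}{\kappa}$ is the space of formal real combinations of words of composition $\kappa$. For $f=\sum_u f_uu\in W_\kappa$ and $w\in\binom{\Sigma}{\mathbf n}$ with $n_x\ge k_x$, $\tilde\# f(w)=\sum_u f_u\,\#u(w)\big/\prod_{x\in\Sigma}\binom{n_x}{k_x}$. Symmetric group action: $S_k$ acts on the right on words of length $k$ by $u\tau=u_{\tau(1)}\cdots u_{\tau(k)}$, extended linearly to the group algebra $A=\mathbb RS_k$. Specht modules: for a partition $\lambda=(\lambda_{\mathtt a}\ge\lambda_{\mathtt b}\ge\cdots)$ of $k$ (trailing zeros allowed), let $\alpha_\lambda=\mathtt a^{\lambda_{\mathtt a}}\mathtt b^{\lambda_{\mathtt b}}\cdots\in\binom{\Sigma}{\lambda}$; let $Q_\lambda\le S_k$ be the group of permutations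 that preserve, for every $j$, the set of positions of the $j$-th occurrences of the letters in $\alpha_\lambda$; let $b_\lambda=\sum_{\tau\in Q_\lambda}\mathrm{sign}(\tau)\tau\in A$. Then $S^\lambda=\alpha_\lambda b_\lambda A\subseteq W_\lambda$. Tables: a table $T=(t_x)_{x\in\Sigma}$ assigns a (possibly empty) word $t_x$ over $\Sigma$ to each letter. Its shape $\lambda(T)$ is given by $\lambda_x=|t_x|$, and its composition $\kappa(T)$ by $k_x=$ the total number of occurrences of $x$ in all the words $t_y$. $T$ is semistandard if $\lambda(T)$ and $\kappa(T)$ are partitions, each $t_x$ is weakly increasing, and each column (the $i$-th letters of $t_{\mathtt a},t_{\mathtt b},\dots$) is strictly increasing. The linear map $\Theta[T]:W_{\lambda(T)}\to W_{\kappa(T)}$ sends a word $u$ to the sum of all distinct words obtained from $u$ by replacing the occurrences of $\mathtt a$ by the letters of $t_{\mathtt a}$ in any order, the occurrences of $\mathtt b$ by the letters of $t_{\mathtt b}$ in any order, and so on. For $r\in\{0,\dots,k-k_{\mathtt a}\}$ define $$W_{\kappa r}=\bigoplus_{T}\Theta[T]\,S^{\lambda(T)}\subseteq W_\kappa,$$ the sum over all semistandard tables $T$ with $\kappa(T)=\kappa$ and $\lambda_{\mathtt a}(T)=k-r$. *)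

(* Defs.v *)
From HB Require Import structures.
From mathcomp Require Import all_boot all_order all_algebra all_fingroup.
From mathcomp Require Import all_classical all_reals all_analysis.

Set Implicit Arguments.
Unset Strict Implicit.
Unset Printing Implicit Defensive.

Import Order.TTheory GRing.Theory Num.Theory.
Import numFieldNormedType.Exports.

Local Open Scope ring_scope.

(* The ordered alphabet is 'I_q.+1, with smallest letter ord0. *)
Definition word (q k : nat) := (k.-tuple 'I_q.+1)%type.

Definition weight (q : nat) (c : 'I_q.+1 -> nat) : nat := (\sum_x c x)%N.

Definition has_composition (q k : nat) (c : 'I_q.+1 -> nat) (w : word q k) : bool :=
  [forall x, count_mem x w == c x].

Definition partition_composition (q : nat) (c : 'I_q.+1 -> nat) : bool :=
  [forall x : 'I_q.+1, forall y : 'I_q.+1, (x <= y)%N ==> (c y <= c x)%N].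

(* All the spaces W_lambda with |lambda| = k sit in this ambient space as the
   combinations supported on the words of composition lambda. *)
Definition comb (R : realType) (q k : nat) := {ffun word q k -> R^o}.

Definition of_word (R : realType) (q k : nat) (u : word q k) : comb R q k :=
  [ffun v => (v == u)%:R].

Definition lin_ext (R : realType) (q k : nat) (phi : word q k -> comb R q k)
    (f : comb R q k) : comb R q k :=
  \sum_u f u *: phi u.

Definition word_perm (q k : nat) (u : word q k) (tau : 'S_k) : word q k :=
  [tuple tnth u (tau i) | i < k].

Definition group_alg (R : realType) (k : nat) := {ffun 'S_k -> R^o}.

(* MathComp composes permutations in the order opposite to the one making
   word_perm a right action, but only iterated actions (f a) a' occur below, never
   products in the group algebra. *)
Definition right_act (R : realType) (q k : nat)
    (f : comb R q k) (a : group_alg R k) : comb R q k :=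
  lin_ext (fun u => \sum_tau a tau *: of_word R (word_perm u tau)) f.

(* The nth default is never reached when |lam| = k. *)
Definition alpha_word (q k : nat) (lam : 'I_q.+1 -> nat) : word q k :=
  [tuple nth ord0 (flatten [seq nseq (lam x) x | x <- enum 'I_q.+1]) i | i < k].

(* Positions of the j-th occurrences of letters, j counted from 0. *)
Definition occurrence_positions (q k : nat) (u : word q k) (j : nat) : {set 'I_k} :=
  [set i : 'I_k | count_mem (tnth u i) (take i u) == j].

Definition column_group (q k : nat) (lam : 'I_q.+1 -> nat) : {set 'S_k} :=
  [set tau : 'S_k | [forall j : 'I_k,
     tau @: occurrence_positions (alpha_word k lam) j
       == occurrence_positions (alpha_word k lam) j]].

Definition column_antisymmetrizer (R : realType) (q k : nat)
    (lam : 'I_q.+1 -> nat) : group_alg R k :=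
  [ffun tau : 'S_k => if tau \in column_group k lam then (-1) ^+ tau else 0].

Definition in_specht (R : realType) (q k : nat) (lam : 'I_q.+1 -> nat)
    (f : comb R q k) : Prop :=
  exists a : group_alg R k,
    f = right_act (right_act (of_word R (alpha_word k lam))
                             (column_antisymmetrizer R k lam)) a.

(* In a table of composition kappa with |kappa| = k no word is longer than k, so the
   length bound loses nothing and makes the tables a finite type. *)
Definition table (q k : nat) := {ffun 'I_q.+1 -> {bseq k of 'I_q.+1}}.

Definition table_shape (q k : nat) (T : table q k) : 'I_q.+1 -> nat :=
  fun x => size (T x).

Definition table_composition (q k : nat) (T : table q k) : 'I_q.+1 -> nat :=
  fun x => (\sum_y count_mem x (T y))%N.

Definition semistandard (q k : nat) (T : table q k) : bool :=
  [&& partition_composition (table_shape T),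
      partition_composition (table_composition T),
      [forall x, sorted leq [seq val y | y <- T x]]
    & [forall x : 'I_q.+1, forall y : 'I_q.+1, forall i : 'I_k,
        [&& (x < y)%N, (i < size (T x))%N & (i < size (T y))%N]
          ==> (nth ord0 (T x) i < nth ord0 (T y) i)%N]].

(* v arises from u by replacing, for each x, the occurrences of x by the letters of
   T x in some order. *)
Definition refills (q k : nat) (T : table q k) (u v : word q k) : bool :=
  [forall x, perm_eq [seq tnth v i | i <- enum 'I_k & tnth u i == x] (T x)].

Definition Theta (R : realType) (q k : nat) (T : table q k) :
    comb R q k -> comb R q k :=
  lin_ext (fun u => \sum_(v | refills T u v) of_word R v).

Definition admissible (q k : nat) (kappa : 'I_q.+1 -> nat) (r : nat)
    (T : table q k) : bool :=
  [&& semistandard T,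
      [forall x, table_composition T x == kappa x]
    & table_shape T ord0 == (k - r)%N].

(* Membership in W_(kappa r), where k = |kappa|. The internal sum of the subspaces
   is taken; its directness is a theorem and not part of the definition. *)
Definition in_W (R : realType) (q k : nat) (kappa : 'I_q.+1 -> nat) (r : nat)
    (f : comb R q k) : Prop :=
  exists2 g : table q k -> comb R q k,
    (forall T, admissible kappa r T -> in_specht (table_shape T) (g T)) &
    f = \sum_(T | admissible kappa r T) Theta T (g T).

(* enum lists the positions in P in increasing order. *)
Definition subword_count (q k m : nat) (u : word q k) (w : word q m) : nat :=
  #|[set P : {set 'I_m} | [seq tnth w i | i <- enum P] == u :> seq 'I_q.+1]|.

Definition subword_density (R : realType) (q k m : nat) (kappa : 'I_q.+1 -> nat)
    (f : comb R q k) (w : word q m) : R :=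
  (\sum_u f u * (subword_count u w)%:R)
    / \prod_x ('C(count_mem x w, kappa x)%:R).

(* Expectation under the uniform distribution on the words of composition c. *)
Definition mean_uniform (R : realType) (q : nat) (c : 'I_q.+1 -> nat)
    (F : word q (weight c) -> R) : R :=
  (\sum_(w | has_composition c w) F w)
    / #|[set w : word q (weight c) | has_composition c w]|%:R.

Local Open Scope classical_set_scope.

Definition varies_to (R : realType) (q : nat) (n_ : nat -> 'I_q.+1 -> nat)
    (p : 'I_q.+1 -> R) : Prop :=
  weight (n_ j) @[j --> \oo] --> \oo /\
  forall x, ((n_ j x)%:R / (weight (n_ j))%:R : R) @[j --> \oo] --> p x.

(* Main.v *)
(** With [F] the extension of [f] by zero, #f(w) #f'(w) is a sum over pairs of
    [k]-subsets of positions; grouping the pairs by their union U, of size M, the mean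
    over w becomes a sum over M of B_M / M!, where B_M sums F(v_Q) F'(v_Q') over the words v
    of length M, weighted by the falling factorials prod_x (n_x)_(c_x(v)), and over the
    covers Q, Q' of the positions of v.  As f and f' live on words of composition kappa,
    the weight only depends on v restricted to Q & Q', so B_M is a combination of products
    of the marginals  f_I(x) = sum_(u : u_I = x) f(u)  with #|I| = 2k - M.

    If f is in W_(kappa r), then f_I = 0 for #|I| < r, because two of the positions
    outside I share a column; and if f_I = 0 for all #|I| = r, then f is orthogonal to
    W_(kappa r).  Hence the mean has order n^(2k - max(r, r')), which gives orthogonality
    in the limit, and for r = r' the leading coefficient is a positive combination, over
    x, of the values on I |-> f_I(x) of the quadratic form counting interleavings.  That form is a tensor
    product of symmetric Pascal matrices, hence positive definite. *)

Require Import Defs.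
From HB Require Import structures.
From mathcomp Require Import all_boot all_order all_algebra all_fingroup.
From mathcomp Require Import all_classical all_reals all_analysis.
From mathcomp Require Import zify ring lra.

Set Implicit Arguments.
Unset Strict Implicit.
Unset Printing Implicit Defensive.

Import Order.TTheory GRing.Theory Num.Theory.
Import numFieldNormedType.Exports.

Local Open Scope ring_scope.

(** * Subwords, covers and marginals *)

Lemma big_tuple_cons (V : nmodType) (T : finType) (n : nat) (F : seq T -> V) :
  \sum_(u : n.+1.-tuple T) F u = \sum_y \sum_(u : n.-tuple T) F (y :: u).
Proof.
rewrite pair_big /= (reindex (fun p : T * n.-tuple T => [tuple of p.1 :: p.2])) //=.
exists (fun u : n.+1.-tuple T => (thead u, [tuple of behead u])).
  by move=> [y u] _ /=; rewrite theadE; congr pair; apply: val_inj.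
by move=> u _; rewrite -tuple_eta.
Qed.

Lemma big_tuple_nil (V : nmodType) (T : finType) (F : seq T -> V) :
  \sum_(u : 0.-tuple T) F u = F [::].
Proof.
by rewrite (bigD1 [tuple]) //= big1 ?addr0 // => u /eqP[]; apply: tuple0.
Qed.

Section Words.
Variables (R : comNzRingType) (T : finType).
Implicit Types (v w x : seq T) (F G : seq T -> R) (I J : seq bool).

(** The letters chosen so far are absorbed into [phi], so identities about sums over position sets
    follow by induction on the word. *)
Fixpoint subword_sum w (phi : seq T -> R) : R :=
  if w is y :: w' then
    subword_sum w' phi + subword_sum w' (fun u => phi (y :: u))
  else phi [::].

(* The sum over all ways to cover [v] by two subwords, the third argument of [psi]
   being the subword read on the positions that belong to both. *)
Fixpoint cover_sum v (psi : seq T -> seq T -> seq T -> R) : R :=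
  if v is y :: v' then
    cover_sum v' (fun u u' x => psi (y :: u) (y :: u') (y :: x))
    + cover_sum v' (fun u u' x => psi (y :: u) u' x)
    + cover_sum v' (fun u u' x => psi u (y :: u') x)
  else psi [::] [::] [::].

(* The positions of a cover, without the letters: each of the two subwords is
   encoded by a mask whose [true] entries are its positions shared with the other. *)
Fixpoint pattern_sum (M : nat) (phi : seq bool -> seq bool -> R) : R :=
  if M is M'.+1 then
    pattern_sum M' (fun I J => phi (true :: I) (true :: J))
    + pattern_sum M' (fun I J => phi (false :: I) J)
    + pattern_sum M' (fun I J => phi I (false :: J))
  else phi [::] [::].

Definition marginal F I x : R :=
  \sum_(u : (size I).-tuple T | mask I u == x) F u.

Lemma eq_subword_sum w (phi phi' : seq T -> R) :
  phi =1 phi' -> subword_sum w phi = subword_sum w phi'.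
Proof.
elim: w phi phi' => [|y w IH] phi phi' e /=; first exact: e.
by congr (_ + _); apply: IH => u; apply: e.
Qed.

Lemma subword_sumD w (phi phi' : seq T -> R) :
  subword_sum w (fun u => phi u + phi' u) = subword_sum w phi + subword_sum w phi'.
Proof.
by elim: w phi phi' => [|y w IH] phi phi' //=; rewrite !IH addrACA.
Qed.

Lemma subword_sumZ w (c : R) phi :
  subword_sum w (fun u => c * phi u) = c * subword_sum w phi.
Proof. by elim: w phi => [|y w IH] phi //=; rewrite !IH -mulrDr. Qed.

(** Each letter of [w] lies in neither subword, in both, or in exactly one of the two. The outer sum
    skips the first case; the other three are the branches of [cover_sum]. *)
Lemma subword_sum_pair w (psi : seq T -> seq T -> R) :
  subword_sum w (fun u => subword_sum w (psi u)) =
  subword_sum w (fun v => cover_sum v (fun u u' _ => psi u u')).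
Proof.
elim: w psi => [|y w IH] psi //=.
rewrite !subword_sumD -!IH /=.
set a := subword_sum w _; set b := subword_sum w _; set c := subword_sum w _.
set d := subword_sum w _.
by rewrite -!addrA; congr (_ + _); rewrite addrCA addrC -!addrA addrC -!addrA.
Qed.

Lemma subword_sumM w (phi phi' : seq T -> R) :
  subword_sum w phi * subword_sum w phi' =
  subword_sum w (fun v => cover_sum v (fun u u' _ => phi u * phi' u')).
Proof.
rewrite -(subword_sum_pair w (fun u u' => phi u * phi' u')) mulrC -subword_sumZ.
by apply: eq_subword_sum => u; rewrite subword_sumZ mulrC.
Qed.

(** The count identity is inclusion-exclusion for a cover; it later recovers the composition of [v]
    from [u], [u'] and the common letters. *)
Lemma eq_cover_sum v (psi psi' : seq T -> seq T -> seq T -> R) :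
    (forall u u' x,
       (forall a : pred T, count a u + count a u' = count a v + count a x)%N ->
       psi u u' x = psi' u u' x) ->
  cover_sum v psi = cover_sum v psi'.
Proof.
elim: v psi psi' => [|y v IH] psi psi' e /=; first exact: e.
congr (_ + _ + _); apply: IH => u u' x c; apply: e => a /=.
- by rewrite addnACA c addnACA.
- by rewrite -addnA c addnA.
- by rewrite addnCA c addnA.
Qed.

Lemma cover_sumZ v (c : R) psi :
  cover_sum v (fun u u' x => c * psi u u' x) = c * cover_sum v psi.
Proof. by elim: v psi => [|y v IH] psi //=; rewrite !IH -!mulrDr. Qed.

Lemma eq_pattern_sum M (phi phi' : seq bool -> seq bool -> R) :
    (forall I J, count id I = count id J ->
       (size I + size J = M + count id I)%N -> phi I J = phi' I J) ->
  pattern_sum M phi = pattern_sum M phi'.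
Proof.
elim: M phi phi' => [|M IH] phi phi' e /=; first exact: e.
congr (_ + _ + _); apply: IH => I J c s; apply: e => /=; lia.
Qed.

Lemma pattern_sum_sum (S : Type) (r : seq S) (P : pred S) M
    (phi : S -> seq bool -> seq bool -> R) :
  pattern_sum M (fun I J => \sum_(i <- r | P i) phi i I J) =
  \sum_(i <- r | P i) pattern_sum M (phi i).
Proof.
by elim: M phi => [|M IH] phi //=; rewrite !IH -!big_split.
Qed.

Lemma pattern_sumZ M (c : R) phi :
  pattern_sum M (fun I J => c * phi I J) = c * pattern_sum M phi.
Proof. by elim: M phi => [|M IH] phi //=; rewrite !IH -!mulrDr. Qed.

Lemma pattern_sum0 M : pattern_sum M (fun _ _ => 0) = 0.
Proof. by elim: M => [|M IH] //=; rewrite !IH !addr0. Qed.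

Lemma marginal_nil F : marginal F [::] [::] = F [::].
Proof.
by rewrite /marginal (eq_bigl xpredT) ?big_tuple_nil // => u; rewrite mask0s.
Qed.

Lemma marginal_true F I y x :
  marginal F (true :: I) (y :: x) = marginal (fun u => F (y :: u)) I x.
Proof.
rewrite /marginal /= big_mkcond /=.
rewrite (big_tuple_cons _ (fun u => if mask (true :: I) u == y :: x then F u else 0)).
rewrite (bigD1 y) //= [X in _ + X]big1 ?addr0.
  by rewrite [RHS]big_mkcond; apply: eq_bigr => u _; rewrite eqseq_cons eqxx.
move=> z zy; apply: big1 => u _.
by rewrite eqseq_cons (negPf zy).
Qed.

Lemma marginal_false F I x :
  marginal F (false :: I) x = \sum_y marginal (fun u => F (y :: u)) I x.
Proof.
rewrite /marginal /= big_mkcond /=.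
rewrite (big_tuple_cons _ (fun u => if mask (false :: I) u == x then F u else 0)).
by apply: eq_bigr => y _; rewrite [RHS]big_mkcond.
Qed.

(** A letter of [v] covered by one subword only is summed freely, which turns [F] or [G] into a
    marginal; the letters on common positions couple the two marginals through [x]. *)
Lemma sum_cover_sum M F G (om : seq T -> R) :
  \sum_(v : M.-tuple T) cover_sum v (fun u u' x => om x * (F u * G u')) =
  pattern_sum M (fun I J => \sum_(x : (count id I).-tuple T)
    om x * (marginal F I x * marginal G J x)).
Proof.
elim: M F G om => [|M IH] F G om.
  by rewrite (big_tuple_nil (fun v => cover_sum v _)) /=
             (big_tuple_nil (fun x => om x * (marginal F _ x * marginal G _ x)))
             !marginal_nil.
rewrite (big_tuple_cons _ (fun v => cover_sum v _)) /=.
under eq_bigr => y _ do rewrite !big_split /=.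
rewrite !big_split /=; congr (_ + _ + _).
- under eq_bigr => y _ do
    rewrite (IH (fun u => F (y :: u)) (fun u => G (y :: u)) (fun u => om (y :: u))).
  rewrite -pattern_sum_sum; apply: eq_pattern_sum => I J c s /=.
  rewrite (big_tuple_cons _ (fun x => om x * (marginal F (true :: I) x
                                             * marginal G (true :: J) x))).
  by apply: eq_bigr => y _; apply: eq_bigr => x _; rewrite !marginal_true.
- under eq_bigr => y _ do rewrite (IH (fun u => F (y :: u)) G om).
  rewrite -pattern_sum_sum; apply: eq_pattern_sum => I J c s /=.
  rewrite exchange_big /=; apply: eq_bigr => x _.
  by rewrite marginal_false mulr_suml mulr_sumr.
- under eq_bigr => y _ do rewrite (IH F (fun u => G (y :: u)) om).
  rewrite -pattern_sum_sum; apply: eq_pattern_sum => I J c s /=.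
  rewrite exchange_big /=; apply: eq_bigr => x _.
  by rewrite marginal_false !mulr_sumr.
Qed.

End Words.

(** * Positivity of the interleaving form *)

(** Counts the ways to reach [J] from [I] by deleting [false] entries: a product of binomial
    coefficients, one for each gap between [true] entries. *)
Fixpoint deletions (I J : seq bool) : nat :=
  match I with
  | [::] => J == [::]
  | true :: I' => if J is true :: J' then deletions I' J' else 0
  | false :: I' => deletions I' J + (if J is false :: J' then deletions I' J' else 0)
  end.

Fixpoint bounded_sum (R : pzSemiRingType) (L : nat) (F : seq bool -> R) : R :=
  F [::] + (if L is L'.+1 then
              bounded_sum L' (fun J => F (true :: J))
              + bounded_sum L' (fun J => F (false :: J))
            else 0).

Lemma deletions_big I J : (size I < size J)%N -> deletions I J = 0%N.
Proof.
elim: I J => [|[] I IH] [|[] J] //= s; try exact: IH.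
  by rewrite !IH //= ltnW.
by rewrite !IH //= ltnW.
Qed.

(** Together with [deletions_big] this makes the matrix [deletions] unitriangular with respect to
    length, which is the source of definiteness. *)
Lemma deletions_same_size I J : size I = size J -> deletions I J = (J == I).
Proof.
elim: I J => [|[] I IH] [|[] J] //= [s]; rewrite ?eqseq_cons /=; first exact: IH.
  by rewrite deletions_big //= s.
by rewrite deletions_big /= ?s // IH.
Qed.

Section BoundedSum.
Variable R : comNzRingType.
Implicit Types F G : seq bool -> R.

Lemma eq_bounded_sum L F G : F =1 G -> bounded_sum L F = bounded_sum L G.
Proof.
elim: L F G => [|L IH] F G e /=; rewrite e //.
by congr (_ + (_ + _)); apply: IH => J; apply: e.
Qed.

Lemma bounded_sum0 L F : (forall J, F J = 0) -> bounded_sum L F = 0.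
Proof. by elim: L F => [|L IH] F e /=; rewrite e ?IH ?addr0. Qed.

Lemma bounded_sumD L F G :
  bounded_sum L (fun J => F J + G J) = bounded_sum L F + bounded_sum L G.
Proof. by elim: L F G => [|L IH] F G /=; rewrite ?IH; ring. Qed.

Lemma bounded_sumZ L (c : R) F :
  bounded_sum L (fun J => c * F J) = c * bounded_sum L F.
Proof. by elim: L F => [|L IH] F /=; rewrite ?IH; ring. Qed.

Lemma bounded_sum_sum (S : Type) (r : seq S) (P : pred S) L (F : S -> seq bool -> R) :
  bounded_sum L (fun J => \sum_(i <- r | P i) F i J) =
  \sum_(i <- r | P i) bounded_sum L (F i).
Proof.
elim: L F => [|L IH] F /=; first by rewrite addr0; apply: eq_bigr => i _; rewrite /= addr0.
by rewrite !IH -!big_split.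
Qed.

Lemma bounded_sum_stable L F :
  (forall J, (L < size J)%N -> F J = 0) -> bounded_sum L.+1 F = bounded_sum L F.
Proof.
elim: L F => [|L IH] F e; first by rewrite /= !addr0 (e [:: true]) // (e [:: false]) // !addr0.
transitivity (F [::] + (bounded_sum L.+1 (fun J => F (true :: J))
                        + bounded_sum L.+1 (fun J => F (false :: J)))) => //.
by congr (_ + (_ + _)); apply: IH => J s; apply: e.
Qed.

(* In every gap between consecutive [true]'s this is the Cholesky factorisation
   C(g + g', g) = sum_j C(g, j) C(g', j) of the symmetric Pascal matrix. *)
Lemma pattern_sum_deletions M L I J :
    (size I <= L)%N -> (size J <= L)%N ->
    count id I = count id J -> (size I + size J = M + count id I)%N ->
  pattern_sum M (fun I' J' => (I' == I)%:R * (J' == J)%:R) =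
  bounded_sum L (fun K => (deletions I K)%:R * (deletions J K)%:R) :> R.
Proof.
elim: M I J L => [|M IH] I J L.
  move=> _ _ c s; have := count_size id I; have := count_size id J => cI cJ.
  have /size0nil-> : size I = 0%N by lia.
  have /size0nil-> : size J = 0%N by lia.
  case: L => [|L] /=; first by rewrite !mulr1 addr0.
  by rewrite !bounded_sum0 ?mulr1 ?addr0 // => K /=; rewrite mul0r.
have p0 (f g : seq bool -> seq bool -> R) :
    (forall I' J', f I' J' * g I' J' = 0) ->
    pattern_sum M (fun I' J' => f I' J' * g I' J') = 0.
  move=> e; rewrite -[RHS](pattern_sum0 R M).
  by apply: eq_pattern_sum => I' J' _ _; apply: e.
(* The heads decide which branches of [pattern_sum] contribute: two [true] heads form a common
   position, and a [false] head facing [true] or an empty mask belongs to one subword alone. Two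
   [false] heads leave two branches. *)
case: I => [|[] I]; case: J => [|[] J] /= sI sJ c s; try discriminate.
- rewrite [X in X + _ + _]p0 ?[X in _ + X + _]p0 ?add0r;
    try by move=> I' J'; rewrite ?eqseq_cons ?mul0r ?mulr0.
  rewrite (IH [::] J L) //=; try lia.
  by apply: eq_bounded_sum => -[|a K] /=; rewrite ?addn0 ?mul0r.
- case: L sI sJ => // L sI sJ.
  rewrite [X in _ + X + _]p0 ?[X in _ + X]p0 ?addr0;
    try by move=> I' J'; rewrite ?eqseq_cons ?mul0r ?mulr0.
  rewrite (IH I J L) /=; try lia.
  rewrite [X in _ + (_ + X)]bounded_sum0 ?mul0r ?add0r ?addr0 //.
- rewrite [X in X + _ + _]p0 ?[X in _ + X + _]p0 ?add0r;
    try by move=> I' J'; rewrite ?eqseq_cons ?mul0r ?mulr0.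
  rewrite (IH (true :: I) J L) //=; try lia.
  by apply: eq_bounded_sum => -[|[] K] /=; rewrite ?addn0 ?mul0r.
- rewrite [X in X + _ + _]p0 ?[X in _ + X]p0 ?add0r ?addr0;
    try by move=> I' J'; rewrite ?eqseq_cons ?mul0r ?mulr0.
  rewrite (IH I [::] L) //=; try lia.
  by apply: eq_bounded_sum => -[|a K] /=; rewrite ?addn0 ?mulr0.
- rewrite [X in X + _ + _]p0 ?[X in _ + X]p0 ?add0r ?addr0;
    try by move=> I' J'; rewrite ?eqseq_cons ?mul0r ?mulr0.
  rewrite (IH I (true :: J) L) //=; try lia.
  by apply: eq_bounded_sum => -[|[] K] /=; rewrite ?addn0 ?mulr0.
- rewrite [X in X + _ + _]p0 ?add0r;
    last by move=> I' J'; rewrite mul0r.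
  rewrite (IH I (false :: J) L) //= 1?(IH (false :: I) J L) //=; try lia.
  (* [sh I] is the part of [deletions (false :: I)] in which the leading [false] is kept. Stripping
     that entry from [K] gives [shE], which plays the role of Pascal's rule. *)
  pose sh I K : nat := if K is false :: K' then deletions I K' else 0%N.
  have shE : bounded_sum L (fun K => (sh I K)%:R * (sh J K)%:R)
      = bounded_sum L (fun K => (deletions I K)%:R * (deletions J K)%:R) :> R.
    case: L sI sJ => // L sI sJ; rewrite [RHS]bounded_sum_stable => [|K sK]; last first.
      by rewrite deletions_big ?mul0r // (leq_ltn_trans _ sK).
    by rewrite /= mul0r add0r bounded_sum0 ?add0r // => K /=; rewrite mul0r.
  rewrite -/(sh I) -/(sh J) -bounded_sumD.
  (* Once the common value of [shE] is added to both sides, the identity holds term by term. *)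
  apply: (addIr (bounded_sum L (fun K => (deletions I K)%:R * (deletions J K)%:R))).
  rewrite -{1}shE -!bounded_sumD; apply: eq_bounded_sum => K.
  by rewrite /= !natrD /sh; ring.
Qed.

End BoundedSum.

Lemma bounded_sum_ge (R : realDomainType) L (F : seq bool -> R) J :
  (forall K, 0 <= F K) -> (size J <= L)%N -> F J <= bounded_sum L F.
Proof.
have ge0 L' G : (forall K, 0 <= G K) -> 0 <= bounded_sum L' G :> R.
  by elim: L' G => [|L' IH] G G0 /=; rewrite ?addr0 ?addr_ge0 ?IH.
elim: L F J => [|L IH] F [|a J] //= F0 s; rewrite ?addr0 // ?lerDl ?addr_ge0 ?ge0 //.
have := IH (fun K => F (a :: K)) J (fun K => F0 _) s.
have := F0 [::]; have := ge0 L _ (fun K => F0 (~~ a :: K)).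
by case: a => /=; lra.
Qed.

(** Expanding [phi] in indicators turns the form into a sum over [K] of the squares of
    [\sum_I phi I * deletions I K]. By unitriangularity the square at [K = I0] is [phi I0 ^+ 2]. *)
Lemma pattern_sum_ge (R : realDomainType) (M k r : nat) (phi : seq bool -> R)
    (I0 : k.-tuple bool) :
    (forall I, phi I != 0 -> size I = k /\ count id I = r) -> (M + r = k + k)%N ->
  phi I0 ^+ 2 <= pattern_sum M (fun I J => phi I * phi J).
Proof.
move=> supp Mr.
have phiE J : phi J = \sum_(I : k.-tuple bool) phi I * (J == I)%:R.
  have [/eqP s|s] := boolP (size J == k).
    rewrite (bigD1 (Tuple (introT eqP s))) //= eqxx mulr1 big1 ?addr0 // => I.
    by rewrite -val_eqE /= eq_sym => /negPf->; rewrite mulr0.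
  rewrite big1 => [|I _].
    by have [//|/supp[/eqP]] := eqVneq (phi J) 0; rewrite (negPf s).
  by rewrite (_ : (J == I) = false) ?mulr0 //; apply/eqP => e; rewrite e size_tuple eqxx in s.
have -> : pattern_sum M (fun I J => phi I * phi J) =
    bounded_sum k (fun K => (\sum_(I : k.-tuple bool) phi I * (deletions I K)%:R) ^+ 2).
  transitivity (pattern_sum M (fun I' J' => \sum_(I : k.-tuple bool)
      \sum_(J : k.-tuple bool) phi I * phi J * ((I' == I)%:R * (J' == J)%:R))).
    apply: eq_pattern_sum => I' J' _ _; rewrite [phi I']phiE [phi J']phiE mulr_suml.
    by apply: eq_bigr => I _; rewrite mulr_sumr; apply: eq_bigr => J _; ring.
  rewrite pattern_sum_sum.
  transitivity (bounded_sum k (fun K => \sum_(I : k.-tuple bool)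
      \sum_(J : k.-tuple bool)
        phi I * phi J * ((deletions I K)%:R * (deletions J K)%:R))); last first.
    apply: eq_bounded_sum => K; rewrite expr2 mulr_suml.
    by apply: eq_bigr => I _; rewrite mulr_sumr; apply: eq_bigr => J _; ring.
  rewrite bounded_sum_sum; apply: eq_bigr => I _.
  rewrite pattern_sum_sum bounded_sum_sum; apply: eq_bigr => J _.
  rewrite pattern_sumZ bounded_sumZ.
  have [->|/supp[_ cI]] := eqVneq (phi I) 0; first by rewrite !mul0r.
  have [->|/supp[_ cJ]] := eqVneq (phi J) 0; first by rewrite mulr0 !mul0r.
  congr (_ * _); apply: pattern_sum_deletions; rewrite ?size_tuple //.
    by rewrite cI cJ.
  by rewrite cI Mr.
have -> : phi I0 ^+ 2 = (\sum_(I : k.-tuple bool) phi I * (deletions I I0)%:R) ^+ 2.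
  rewrite [in LHS]phiE; congr (_ ^+ 2); apply: eq_bigr => I _.
  by rewrite deletions_same_size ?size_tuple.
apply: (@bounded_sum_ge _ _ (fun K => (\sum_I phi (tval I) * (deletions I K)%:R) ^+ 2)).
  by move=> K; apply: sqr_ge0.
by rewrite size_tuple.
Qed.

(** * Marginals of elements of Specht modules *)

Lemma mask_tnth (T : Type) (k : nat) (I : k.-tuple bool) (u : k.-tuple T) :
  mask I u = [seq tnth u i | i <- enum 'I_k & tnth I i].
Proof.
by rewrite -[in LHS](map_tnth_enum u) -map_mask -[in LHS](map_tnth_enum I) -filter_mask.
Qed.

Lemma perm_eq_enum_perm (k : nat) (s : 'S_k) : perm_eq (map s (enum 'I_k)) (enum 'I_k).
Proof.
apply: uniq_perm; rewrite ?(map_inj_uniq perm_inj) ?enum_uniq // => i.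
by rewrite mem_enum -[i](permKV s) map_f ?mem_enum.
Qed.

Section SpechtModules.
Variables (R : realType) (q k : nat).
Implicit Types (u v w : word q k) (lam kappa : 'I_q.+1 -> nat) (f g : comb R q k).

Lemma word_permM u (s t : 'S_k) : word_perm (word_perm u s) t = word_perm u (t * s)%g.
Proof. by apply: eq_from_tnth => i; rewrite !tnth_mktuple permM. Qed.

Lemma word_permE u (t : 'S_k) : word_perm u t = map (tnth u) (map t (enum 'I_k)) :> seq _.
Proof. by rewrite -map_comp. Qed.

Lemma perm_word_perm u (t : 'S_k) : perm_eq (word_perm u t) u.
Proof.
rewrite word_permE -[X in perm_eq _ X]map_tnth_enum.
exact: perm_map (perm_eq_enum_perm t).
Qed.

Lemma count_alpha_word lam x : weight lam = k -> count_mem x (alpha_word k lam) = lam x.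
Proof.
move=> hlam; set s := flatten [seq nseq (lam y) y | y <- enum 'I_q.+1].
have sE : size s = k.
  rewrite size_flatten /shape -map_comp sumnE big_map -hlam /weight big_enum.
  by apply: eq_bigr => y _; rewrite /= size_nseq.
have -> : alpha_word k lam = s :> seq _.
  apply: (@eq_from_nth _ ord0); rewrite ?size_tuple ?sE // => i ik.
  by rewrite -[i]/(val (Ordinal ik)) -tnth_nth tnth_mktuple.
rewrite count_flatten -map_comp sumnE big_map big_enum (bigD1 x) //= big1 => [|y yx].
  by rewrite count_nseq /= eqxx mul1n addn0.
by rewrite count_nseq /= (negPf yx).
Qed.

Lemma has_composition_alpha lam : weight lam = k -> has_composition lam (alpha_word k lam).
Proof. by move=> h; apply/forallP => x; rewrite count_alpha_word. Qed.

Lemma has_composition_word_perm lam u (t : 'S_k) :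
  has_composition lam (word_perm u t) = has_composition lam u.
Proof.
by apply: eq_forallb => x; rewrite (seq.permP (perm_word_perm u t)).
Qed.

Lemma sum_of_word v (c : word q k -> R) : \sum_u of_word R v u * c u = c v.
Proof.
rewrite (bigD1 v) //= ffunE eqxx mul1r big1 ?addr0 // => u uv.
by rewrite ffunE (negPf uv) mul0r.
Qed.

(** Module elements are only ever examined through pairings with a test function [c], so each
    operator is moved onto [c] as its adjoint. *)
Lemma sum_lin_ext (phi : word q k -> comb R q k) f (c : word q k -> R) :
  \sum_u lin_ext phi f u * c u = \sum_u f u * (\sum_v phi u v * c v).
Proof.
rewrite /lin_ext; under eq_bigr => u _ do rewrite sum_ffunE mulr_suml.
rewrite exchange_big; apply: eq_bigr => v _; rewrite mulr_sumr.
by apply: eq_bigr => u _; rewrite ffunE mulrA.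
Qed.

Lemma sum_right_act f (a : group_alg R k) (c : word q k -> R) :
  \sum_u right_act f a u * c u = \sum_u f u * (\sum_t a t * c (word_perm u t)).
Proof.
rewrite sum_lin_ext; apply: eq_bigr => u _; congr (_ * _).
under eq_bigr => v _ do rewrite sum_ffunE mulr_suml.
rewrite exchange_big; apply: eq_bigr => t _.
under eq_bigr => v _ do rewrite ffunE -mulrA.
by rewrite -mulr_sumr sum_of_word.
Qed.

Lemma sum_Theta (T : table q k) f (c : word q k -> R) :
  \sum_u Theta T f u * c u = \sum_u f u * (\sum_(v | refills T u v) c v).
Proof.
rewrite sum_lin_ext; apply: eq_bigr => u _; congr (_ * _).
under eq_bigr => v _ do rewrite sum_ffunE mulr_suml.
by rewrite exchange_big; apply: eq_bigr => t _; rewrite sum_of_word.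
Qed.

(** By linearity in the last group algebra factor, it suffices to translate the antisymmetrized word
    by a single permutation [t]. *)
Lemma specht_sum_eq0 lam g (c : word q k -> R) : in_specht lam g ->
    (forall t : 'S_k, \sum_s column_antisymmetrizer R k lam s
        * c (word_perm (alpha_word k lam) (t * s)%g) = 0) ->
  \sum_u g u * c u = 0.
Proof.
move=> [a ->] h; rewrite !sum_right_act sum_of_word.
under eq_bigr => s _ do rewrite mulr_sumr.
rewrite exchange_big /= big1 // => t _.
have := congr1 ( *%R (a t)) (h t); rewrite mulr0 mulr_sumr => e.
apply: etrans e; apply: eq_bigr => s _.
by rewrite word_permM mulrCA.
Qed.

Lemma specht_support lam g u :
  weight lam = k -> in_specht lam g -> g u != 0 -> has_composition lam u.
Proof.
move=> hlam hg; apply: contraNT => nu; apply/eqP.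
rewrite -(sum_of_word u g); under eq_bigr => v _ do rewrite mulrC.
apply: (specht_sum_eq0 hg) => t; apply: big1 => s _.
rewrite [X in _ * X]ffunE; case: eqP => [e|_]; last by rewrite mulr0.
by case/negP: nu; rewrite -e has_composition_word_perm has_composition_alpha.
Qed.

Lemma refills_word_perm (T : table q k) u v (t : 'S_k) :
  refills T (word_perm u t) (word_perm v t) = refills T u v.
Proof.
apply: eq_forallb => x.
have -> : [seq tnth (word_perm v t) i | i <- enum 'I_k & tnth (word_perm u t) i == x]
   = [seq tnth v i | i <- map t (enum 'I_k) & tnth u i == x].
  elim: (enum 'I_k) => //= i s IH; rewrite !tnth_mktuple.
  by case: ifP => _ /=; rewrite ?tnth_mktuple IH.
apply: (permPl _ (T x)); apply: perm_map; exact/perm_filter/perm_eq_enum_perm.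
Qed.

Lemma sum_count_fibers (P : pred 'I_q.+1) u v :
  (\sum_x count P [seq tnth v i | i <- enum 'I_k & tnth u i == x] = count P v)%N.
Proof.
rewrite -[in RHS](map_tnth_enum v) count_map -sum1_count [RHS]big_mkcond /=.
under eq_bigr => x _ do rewrite count_map count_filter -sum1_count big_mkcond /=.
rewrite exchange_big /=; apply: eq_bigr => i _.
rewrite -big_mkcond /=; case: (P _) => /=; last by rewrite big_pred0.
by rewrite (eq_bigl (pred1 (tnth u i))) ?big_pred1_eq // => x; rewrite /= eq_sym.
Qed.

Lemma refills_composition (T : table q k) u v :
  refills T u v -> has_composition (table_composition T) v.
Proof.
move=> /forallP h; apply/forallP => y; rewrite -(sum_count_fibers _ u v).
by apply/eqP; apply: eq_bigr => x _; apply/seq.permP.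
Qed.

(** The level sets are the [occurrence_positions], that is, the columns of the tableau, numbered
    from 0. *)
Definition column_of u (i : 'I_k) : nat := count_mem (tnth u i) (take i u).

Lemma tperm_column_group lam (i j : 'I_k) (s : 'S_k) :
  column_of (alpha_word k lam) i = column_of (alpha_word k lam) j ->
  ((tperm i j * s)%g \in column_group k lam) = (s \in column_group k lam).
Proof.
move=> ij; rewrite !inE; apply: eq_forallb => l; congr (_ == _).
set O := occurrence_positions _ _.
suff tO : tperm i j @: O = O.
  rewrite -[in RHS]tO -imset_comp; apply: eq_imset => a /=.
  by rewrite permM.
apply/eqP; rewrite eqEcard card_imset ?leqnn ?andbT; last exact: perm_inj.
apply/fintype.subsetP => _ /imsetP[a aO ->].
by case: tpermP aO => [->|->|//]; rewrite !inE -!/(column_of _ _) ij.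
Qed.

Lemma column_antisymmetrizer_tperm lam (i j : 'I_k) (s : 'S_k) :
  i != j -> column_of (alpha_word k lam) i = column_of (alpha_word k lam) j ->
  column_antisymmetrizer R k lam (tperm i j * s)%g = - column_antisymmetrizer R k lam s.
Proof.
move=> nij ij; rewrite !ffunE tperm_column_group //.
by case: ifP => _; rewrite ?oppr0 // odd_permM odd_tperm nij signr_addb expr1 mulN1r.
Qed.

(** No row is longer than the first, so the first row bounds the number of columns; this is the
    bound for the pigeonhole argument. *)
Lemma column_of_alpha lam (i : 'I_k) : weight lam = k -> partition_composition lam ->
  (column_of (alpha_word k lam) i < lam ord0)%N.
Proof.
move=> hlam /forallP/(_ ord0)/forallP/(_ (tnth (alpha_word k lam) i))/implyP/(_ isT).
apply: leq_trans; rewrite -[X in (_ < X)%N](count_alpha_word _ hlam).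
set a := alpha_word k lam; rewrite /column_of -(congr1 (count_mem (tnth a i)) (cat_take_drop i a)).
rewrite count_cat (drop_nth ord0) ?size_tuple // -(tnth_nth ord0 a i).
by rewrite -cat1s count_cat /= eqxx -addn1 leq_add2l.
Qed.

(* More than [lam ord0] positions meet some column of [lam] twice, and the transposition
   of two such positions changes the sign of the antisymmetrizer but not [c]. *)
Lemma specht_sum_invariant lam g (c : word q k -> R) (J : {set 'I_k}) :
    weight lam = k -> partition_composition lam -> in_specht lam g ->
    (lam ord0 < #|J|)%N ->
    (forall i j u, i \in J -> j \in J -> c (word_perm u (tperm i j)) = c u) ->
  \sum_u g u * c u = 0.
Proof.
move=> hlam plam hg hJ cJ; apply: (specht_sum_eq0 hg) => t.
set a := alpha_word k lam.
have [i [j [iJ jJ nij ij]]] : exists i j, [/\ i \in J, j \in J, i != j &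
    column_of a (t i) = column_of a (t j)].
  pose h i := Ordinal (column_of_alpha (t i) hlam plam).
  have /dinjectivePn[i iJ [j]] : ~~ dinjectiveb h J.
    apply/negP => /dinjectiveP/card_in_image e.
    have := max_card (mem [seq h x | x in J]); rewrite e card_ord leqNgt => /negP; exact.
  rewrite !inE => /andP[ji jJ] /(congr1 val) /= e.
  by exists i, j; rewrite eq_sym.
set S := \sum_s _; suff : S = - S by lra.
rewrite {1}/S (reindex_inj (mulgI (tperm (t i) (t j)))) /= -sumrN.
apply: eq_bigr => s _; rewrite column_antisymmetrizer_tperm ?(inj_eq perm_inj) //.
rewrite mulNr; congr (- (_ * _)).
(* Moving the transposition past [t] conjugates it into [tperm i j], under which [c] is
   invariant. *)
have -> : (t * (tperm (t i) (t j) * s) = tperm i j * (t * s))%g.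
  by rewrite -tpermJ /conjg !mulgA mulgV mul1g.
by rewrite -word_permM cJ.
Qed.

End SpechtModules.

(** * Marginals of elements of W_(kappa r): vanishing below size r, non-vanishing at size r *)

Section InW.
Variables (R : realType) (q k : nat).
Implicit Types (u v w : word q k) (kappa : 'I_q.+1 -> nat) (f g : comb R q k).
Implicit Types (T : table q k) (I : k.-tuple bool).

Definition comb_fun f (s : seq 'I_q.+1) : R :=
  if insub s is Some u then f u else 0.

Lemma comb_fun_tuple f u : comb_fun f u = f u.
Proof. by rewrite /comb_fun valK. Qed.

Lemma marginal_comb_fun f I x :
  marginal (comb_fun f) I x = \sum_(u : word q k | mask I u == x) f u.
Proof.
by rewrite /marginal size_tuple; apply: eq_bigr => u _; rewrite comb_fun_tuple.
Qed.

Lemma word_perm_inj (t : 'S_k) : injective (fun u => word_perm u t).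
Proof.
apply: (can_inj (g := fun u => word_perm u t^-1%g)) => u.
by rewrite word_permM mulVg; apply: eq_from_tnth => i; rewrite tnth_mktuple perm1.
Qed.

Lemma weight_table_shape T : weight (table_shape T) = weight (table_composition T).
Proof.
rewrite /weight exchange_big; apply: eq_bigr => x _; rewrite /table_shape.
elim: (val (T x)) => [|y s IH] /=; first by rewrite big1.
rewrite big_split /= -IH (bigD1 y) //= eqxx big1 // => z zy.
by rewrite eq_sym (negPf zy).
Qed.

Lemma card_false I : #|[set i | ~~ tnth I i]| = (k - count id I)%N.
Proof.
rewrite cardsE cardE /enum_mem size_filter -enumT.
have := count_predC (tnth I) (enum 'I_k); rewrite size_enum_ord => e.
rewrite -[X in count id X]map_tnth_enum count_map -[X in (X - _)%N]e addKn.
by apply: eq_count => i; rewrite /= ?inE.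
Qed.

Lemma mask_word_perm I u (i j : 'I_k) :
  ~~ tnth I i -> ~~ tnth I j -> mask I (word_perm u (tperm i j)) = mask I u.
Proof.
move=> Ii Ij; rewrite !mask_tnth; apply/eq_in_map => a.
rewrite mem_filter => /andP[Ia _]; rewrite tnth_mktuple.
by case: tpermP => // e; rewrite -e Ia in Ii Ij.
Qed.

Lemma admissible_shape kappa r T : weight kappa = k -> admissible kappa r T ->
  [/\ weight (table_shape T) = k, partition_composition (table_shape T),
      table_shape T ord0 = (k - r)%N & table_composition T =1 kappa].
Proof.
move=> hk /and3P[/and4P[pT _ _ _] /forallP cT /eqP s0].
have {}cT : table_composition T =1 kappa by move=> x; apply/eqP.
split=> //; rewrite weight_table_shape -[RHS]hk.
by apply: eq_bigr => x _; apply: cT.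
Qed.

Lemma in_W_sum kappa r f (c : word q k -> R) : in_W kappa r f ->
    (forall T g, admissible kappa r T -> in_specht (table_shape T) g ->
       \sum_u g u * (\sum_(v | refills T u v) c v) = 0) ->
  \sum_u f u * c u = 0.
Proof.
move=> [g hg ->] h; under eq_bigr => u _ do rewrite sum_ffunE mulr_suml.
rewrite exchange_big /=; apply: big1 => T aT.
by rewrite sum_Theta; apply: h => //; apply: hg.
Qed.

Lemma in_W_support kappa r f u : in_W kappa r f -> f u != 0 -> has_composition kappa u.
Proof.
move=> hf; apply: contraNT => nu; apply/eqP.
rewrite -(sum_of_word u f); under eq_bigr => v _ do rewrite mulrC.
apply: (in_W_sum hf) => T g /and3P[_ /forallP cT _] _.
apply: big1 => w _; rewrite big1 ?mulr0 // => v /refills_composition/forallP cv.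
rewrite ffunE; case: eqP => // e; case/negP: nu; rewrite -e; apply/forallP => x.
by rewrite (eqP (cv x)).
Qed.

(** More than [k - r] positions lie outside [I], and [k - r] is the length of the first row of each
    admissible shape. Refilling commutes with permuting positions, so the test function is invariant
    under transpositions outside [I] and [specht_sum_invariant] applies. *)
Lemma in_W_marginal0 kappa r f I (x : seq 'I_q.+1) :
    weight kappa = k -> (r <= k)%N -> in_W kappa r f -> (count id I < r)%N ->
  marginal (comb_fun f) I x = 0.
Proof.
move=> hk rk hf cI; rewrite marginal_comb_fun big_mkcond /=.
transitivity (\sum_(u : word q k) f u * (mask I u == x)%:R).
  by apply: eq_bigr => u _; case: eqP; rewrite ?mulr1 ?mulr0.
apply: (in_W_sum hf) => T g aT hg; have [hs ps s0 _] := admissible_shape hk aT.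
apply: (specht_sum_invariant (J := [set i | ~~ tnth I i]) hs ps hg).
  by rewrite card_false s0; lia.
move=> i j u; rewrite !inE => Ii Ij.
rewrite (reindex_inj (@word_perm_inj (tperm i j))) /=.
by apply: eq_big => v; rewrite ?refills_word_perm // mask_word_perm.
Qed.

Lemma sum_mask I (rho : seq 'I_q.+1 -> R) f :
    (forall x, marginal (comb_fun f) I x = 0) ->
  \sum_(u : word q k) rho (mask I u) * f u = 0.
Proof.
move=> h; pose m := count id I.
transitivity (\sum_(u : word q k) \sum_(x : m.-tuple 'I_q.+1 | mask I u == x) rho x * f u).
  apply: eq_bigr => u _.
  have s : size (mask I u) == m by rewrite size_mask ?size_tuple.
  rewrite (bigD1 (Tuple s)) //= big1 ?addr0 // => x /andP[/eqP e].
  by rewrite -val_eqE /= e eqxx.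
rewrite (exchange_big_dep xpredT) //=; apply: big1 => x _.
by rewrite -mulr_sumr -marginal_comb_fun h mulr0.
Qed.

(* The positions of [u] carrying a letter other than the first one determine which
   words refill [u], because the composition then fixes the remaining letters. *)
Lemma sum_refills0 kappa T f u :
    (forall v, f v != 0 -> has_composition kappa v) ->
    table_composition T =1 kappa -> has_composition (table_shape T) u ->
    (forall I (x : seq 'I_q.+1), count id I = (k - table_shape T ord0)%N ->
       marginal (comb_fun f) I x = 0) ->
  \sum_(v | refills T u v) f v = 0.
Proof.
move=> supp cT /forallP su h.
pose I := [tuple tnth u i != ord0 | i < k].
have cI : count id I = (k - table_shape T ord0)%N.
  have e := count_predC (fun i => tnth u i == ord0) (enum 'I_k).
  rewrite size_enum_ord in e; rewrite -[X in (X - _)%N]e -(eqP (su ord0)).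
  rewrite -[in RHS](map_tnth_enum u) !count_map addKn.
  by apply: eq_count => i; rewrite /= ?inE.
pose part x v := [seq tnth v i | i <- enum 'I_k & tnth u i == x].
pose P v := [forall x, (x != ord0) ==> perm_eq (part x v) (T x)].
(* [P] speaks of words of length [k], while [rho] must be a function of the letters on [I] alone;
   the existential gives one, and [PE] shows that the choice of the word does not matter. *)
pose rho s : R := [exists v : word q k, (mask I v == s) && P v]%:R.
have PE v : rho (mask I v) = (P v)%:R.
  congr (_%:R); apply: congr1; apply/existsP/idP => [[v' /andP[/eqP e Pv']]|Pv]; last first.
    by exists v; rewrite eqxx.
  apply/forallP => x; apply/implyP => x0.
  suff -> : part x v = part x v' by apply: (implyP (forallP Pv' x)).
  apply/eq_in_map => i; rewrite mem_filter => /andP[/eqP ui _].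
  move: e; rewrite !mask_tnth => /eq_in_map/(_ i)-> //.
  by rewrite mem_filter mem_enum tnth_mktuple ui x0.
rewrite big_mkcond -[RHS](sum_mask rho (h I ^~ cI)); apply: eq_bigr => v _.
rewrite PE; have [->|/supp/forallP cv] := eqVneq (f v) 0; first by rewrite mulr0 if_same.
suff -> : refills T u v = P v by case: (P v); rewrite ?mul1r ?mul0r.
apply/forallP/forallP => [r x|Pv x]; first by apply/implyP => _; apply: r.
have [->|x0] := eqVneq x ord0; last exact: (implyP (Pv x)).
apply/allP => y _ /=; apply/eqP.
have := sum_count_fibers (pred1 y) u v; rewrite (eqP (cv y)) -cT /table_composition.
rewrite (bigD1 ord0) //= [RHS](bigD1 ord0) //= => e.
apply/eqP; rewrite -(eqn_add2r (\sum_(i < q.+1 | i != ord0) count_mem y (T i))%N) -e.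
rewrite eqn_add2l; apply/eqP; apply: eq_bigr => z z0.
by apply/esym/seq.permP; apply: (implyP (Pv z)).
Qed.

(** If all marginals of size [r] vanished, [sum_refills0] would make [f] orthogonal to every summand
    of W_(kappa r), hence to itself. *)
Lemma in_W_marginal_neq0 kappa r f :
    weight kappa = k -> (r <= k)%N -> in_W kappa r f -> f != 0 ->
  exists I (x : seq 'I_q.+1), count id I = r /\ marginal (comb_fun f) I x != 0.
Proof.
move=> hk rk hf f0; apply: contrapT => h.
have {}h I (x : seq 'I_q.+1) : count id I = r -> marginal (comb_fun f) I x = 0.
  by move=> cI; apply: contrapT => /eqP e; apply: h; exists I, x.
have : \sum_u f u * f u = 0.
  apply: (in_W_sum hf) => T g aT hg; have [hs ps s0 cT] := admissible_shape hk aT.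
  apply: big1 => u _; have [->|/(specht_support hs hg) cu] := eqVneq (g u) 0.
    by rewrite mul0r.
  rewrite (sum_refills0 (fun v => in_W_support (u := v) hf) cT cu) ?mulr0 // => I x.
  by rewrite s0 subKn //; apply: h.
move/eqP; rewrite psumr_eq0 => [/allP z|u _]; last exact: sqr_ge0.
case/negP: f0; apply/eqP/ffunP => u; rewrite ffunE.
by have := z u (mem_index_enum u); rewrite mulf_eq0 orbb => /eqP.
Qed.

End InW.

(** * Moments under the uniform distribution *)

Section UniformWords.
Variable q : nat.
Implicit Types (c : 'I_q.+1 -> nat) (v : seq 'I_q.+1).

Definition ffact_word c v : nat := (\prod_x c x ^_ (count_mem x v))%N.

Lemma ffact_word_cons c y v :
  ffact_word c (y :: v) = (ffact_word c v * (c y - count_mem y v))%N.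
Proof.
rewrite /ffact_word (bigD1 y) //= [in RHS](bigD1 y) //= eqxx add1n ffactnSr.
rewrite mulnAC; congr (_ * _ * _)%N; apply: eq_bigr => x /negPf xy.
by rewrite eq_sym xy.
Qed.

Lemma sum_tnth_eq (m : nat) c (s : seq 'I_m) v : uniq s -> size v = size s ->
  (m ^_ (size s) * \sum_(w : word q m | has_composition c w) (map (tnth w) s == v)
   = #|[set w : word q m | has_composition c w]| * ffact_word c v)%N.
Proof.
elim: s v => [|i s IH] [|y v] //=.
  move=> _ _; rewrite /ffact_word [X in _ = (_ * X)%N]big1 // ffactn0 mul1n muln1.
  by rewrite cardsE -sum1_card.
move=> /andP[is_ us] [sv].
pose H j := (\sum_(w : word q m | has_composition c w) (map (tnth w) (j :: s) == y :: v))%N.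
have Hij j : j \notin s -> H j = H i.
  move=> js; rewrite /H (reindex_inj (@word_perm_inj _ _ (tperm i j))) /=.
  apply: eq_big => w; first exact: has_composition_word_perm.
  move=> _; rewrite !tnth_mktuple tpermR; congr (nat_of_bool (_ :: _ == _)).
  apply/eq_in_map => a sa; rewrite tnth_mktuple tpermD //.
    by apply: contraNneq is_ => ->.
  by apply: contraNneq js => ->.
have HE : ((m - size s) * H i =
    (\sum_(w : word q m | has_composition c w) (map (tnth w) s == v))
      * (c y - count_mem y v))%N.
  transitivity (\sum_(j | j \notin s) H j)%N.
    rewrite (eq_bigr (fun=> H i)) // sum_nat_const; congr (_ * _)%N.
    have := cardC (mem s); rewrite card_ord (card_uniqP us) => e.
    by rewrite -[X in (X - _)%N]e addKn.
  rewrite exchange_big big_distrl /=; apply: eq_bigr => w /forallP cw.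
  under eq_bigr => j _ do rewrite eqseq_cons -mulnb.
  rewrite -big_distrl /= mulnC; case: eqP => [e|]; rewrite ?mul0n // !mul1n.
  rewrite -(eqP (cw y)) -e -[X in (count_mem y X - _)%N](map_tnth_enum w) !count_map.
  have cE (r : seq 'I_m) : count (preim (tnth w) (pred1 y)) r
      = (\sum_(j <- r) (tnth w j == y))%N.
    by rewrite -sum1_count big_mkcond.
  rewrite !cE -enumT big_enum (big_uniq _ us) /=.
  by rewrite [in RHS](bigID (mem s)) /= addKn.
rewrite ffactnSr -mulnA HE mulnA IH // -mulnA; congr (_ * _)%N.
by rewrite ffact_word_cons.
Qed.

Lemma sum_mask_tuple (R : comNzRingType) (T : finType) (m : nat) (w : seq T) (psi : seq T -> R) :
  size w = m -> \sum_(b : m.-tuple bool) psi (mask b w) = subword_sum w psi.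
Proof.
elim: w m psi => [|y w IH] [|m] psi //= => [_|[s]].
  by rewrite (big_tuple_nil (fun b => psi (mask b [::]))).
rewrite (big_tuple_cons _ (fun b => psi (mask b (y :: w)))) big_bool /= addrC.
by rewrite -(IH m psi) // -(IH m (fun u => psi (y :: u))).
Qed.

Lemma sum_set_tnth (R : comNzRingType) (T : finType) (m : nat) (w : m.-tuple T)
    (psi : seq T -> R) :
  \sum_(P : {set 'I_m}) psi [seq tnth w i | i <- enum P] = subword_sum w psi.
Proof.
rewrite -(@sum_mask_tuple _ _ m) ?size_tuple //.
rewrite (reindex (fun b : m.-tuple bool => [set i | tnth b i])) /=; last first.
  exists (fun P : {set 'I_m} => [tuple i \in P | i < m]) => [b _|P _].
    by apply: eq_from_tnth => i; rewrite tnth_mktuple inE.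
  by apply/setP => i; rewrite inE tnth_mktuple.
apply: eq_bigr => b _; rewrite mask_tnth [in LHS]/enum_mem -enumT.
by congr (psi (map _ _)); apply: eq_filter => i; rewrite /= inE.
Qed.

Lemma sum_set_card (R : comNzRingType) (m : nat) (G : nat -> R) :
  \sum_(P : {set 'I_m}) G #|P| = \sum_(M < m.+1) 'C(m, M)%:R * G M.
Proof.
rewrite (partition_big (fun P : {set 'I_m} => inord #|P| : 'I_m.+1) xpredT) //=.
apply: eq_bigr => M _; have e (P : {set 'I_m}) : (inord #|P| == M :> 'I_m.+1) = (#|P| == M).
  by rewrite -val_eqE /= inordK // ltnS -[X in (_ <= X)%N]card_ord max_card.
rewrite (eq_bigr (fun=> G M)) => [|P]; last by rewrite e => /eqP->.
rewrite (eq_bigl (fun P => P \in [set A : {set 'I_m} | #|A| == M])) => [|P]; last first.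
  by rewrite e inE.
by rewrite sumr_const card_draws card_ord mulr_natl.
Qed.

(** All position sets of size M have the same mean contribution, with denominator [m ^_ M]; there
    are ['C(m, M)] of them, and the quotient of the two is [1 / M!]. *)
Lemma mean_subword_sum (R : realType) c (psi : seq 'I_q.+1 -> R) :
  mean_uniform (fun w : word q (weight c) => subword_sum w psi) =
  \sum_(M < (weight c).+1)
     (\sum_(v : M.-tuple 'I_q.+1) (ffact_word c v)%:R * psi v) / (M`!)%:R.
Proof.
rewrite /mean_uniform; set m := weight c; set Z := #|_|.
have Z0 : Z%:R != 0 :> R.
  rewrite pnatr_eq0 -lt0n; apply/card_gt0P; exists (alpha_word m c).
  by rewrite inE has_composition_alpha.
apply: (mulIf Z0); rewrite divfK //.
under eq_bigr => w _ do rewrite -sum_set_tnth.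
rewrite exchange_big /=.
pose G M := Z%:R * (\sum_(v : M.-tuple 'I_q.+1) (ffact_word c v)%:R * psi v) / (m ^_ M)%:R.
transitivity (\sum_(P : {set 'I_m}) G #|P|).
  apply: eq_bigr => P _.
  have Pm : (#|P| <= m)%N by rewrite -[X in (_ <= X)%N]card_ord max_card.
  have f0 : (m ^_ #|P|)%:R != 0 :> R by rewrite pnatr_eq0 -lt0n ffact_gt0.
  apply: (mulIf f0); rewrite divfK // mulr_sumr mulr_suml.
  transitivity (\sum_(w : word q m | has_composition c w) \sum_(v : #|P|.-tuple 'I_q.+1)
      psi v * (m ^_ #|P|)%:R * ([seq tnth w i | i <- enum P] == v)%:R).
    apply: eq_bigr => w _; have s : size [seq tnth w i | i <- enum P] == #|P|.
      by rewrite size_map -cardE.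
    rewrite (bigD1 (Tuple s)) //= eqxx mulr1 big1 ?addr0 // => v.
    by rewrite -val_eqE /= eq_sym => /negPf->; rewrite mulr0.
  rewrite exchange_big; apply: eq_bigr => v _ /=.
  rewrite -mulr_sumr -natr_sum -mulrA -natrM.
  have := sum_tnth_eq c (enum_uniq P) (v := v); rewrite -cardE size_tuple => -> //.
  by rewrite natrM; ring.
rewrite sum_set_card mulr_suml; apply: eq_bigr => M _.
have Mm : (M <= m)%N by rewrite -ltnS.
have f0 : ('C(m, M))%:R != 0 :> R by rewrite pnatr_eq0 -lt0n bin_gt0.
have f1 : (M`!)%:R != 0 :> R by rewrite pnatr_eq0 -lt0n fact_gt0.
by rewrite /G -bin_ffact natrM; field; rewrite f0 f1.
Qed.

Lemma sum_subword_count (R : realType) (k m : nat) (f : comb R q k) (w : word q m) :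
  \sum_u f u * (subword_count u w)%:R = subword_sum w (comb_fun f).
Proof.
rewrite -sum_set_tnth.
under eq_bigr => u _ do rewrite /subword_count -sum1_card natr_sum big_mkcond mulr_sumr.
rewrite exchange_big; apply: eq_bigr => P _ /=.
under eq_bigr => u _ do rewrite inE.
rewrite /comb_fun; case: insubP => [v _ <-|ns].
  rewrite (bigD1 v) //= eqxx mulr1 big1 ?addr0 // => u uv.
  by rewrite val_eqE eq_sym (negPf uv) mulr0.
rewrite big1 // => u _; case: eqP => [e|_]; rewrite ?mulr0 //.
by case/negP: ns; rewrite e size_tuple.
Qed.

(** The normalisation depends on the composition alone and leaves the mean; the product of two
    subword sums becomes one sum over covers. *)
Lemma mean_density (R : realType) (k : nat) c kappa (f g : comb R q k) :
  mean_uniform (fun w : word q (weight c) =>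
    subword_density kappa f w * subword_density kappa g w) =
  (\sum_(M < (weight c).+1) (\sum_(v : M.-tuple 'I_q.+1) (ffact_word c v)%:R
       * cover_sum v (fun u u' _ => comb_fun f u * comb_fun g u')) / (M`!)%:R)
  / (\prod_x ('C(c x, kappa x)%:R)) ^+ 2.
Proof.
rewrite -(mean_subword_sum c (fun v =>
  cover_sum v (fun u u' _ => comb_fun f u * comb_fun g u'))).
rewrite /mean_uniform [RHS]mulrAC [in RHS]mulr_suml; congr (_ / _); apply: eq_bigr => w /forallP cw.
rewrite /subword_density.
have -> : \prod_x 'C(count_mem x w, kappa x)%:R = \prod_x 'C(c x, kappa x)%:R :> R.
  by apply: eq_bigr => x _; rewrite (eqP (cw x)).
rewrite !sum_subword_count mulrACA -invfM -expr2; congr (_ / _).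
exact: subword_sumM.
Qed.

End UniformWords.

(** * Coefficients of the second moment: where they vanish and the sign of the leading one *)

Section CoverCoefficients.
Variables (R : realType) (q k : nat) (kappa : 'I_q.+1 -> nat).
Hypothesis hk : weight kappa = k.
Implicit Types (f g : comb R q k) (s x : seq 'I_q.+1) (e : 'I_q.+1 -> nat -> R).

(** The weight [e] stays general: it is a falling factorial before the limit and a power of [p] in
    the limit. *)
Definition letter_weight e s : R := \prod_a e a (count_mem a s).

Definition cover_coef e f g (M : nat) : R :=
  \sum_(v : M.-tuple 'I_q.+1) letter_weight e v
    * cover_sum v (fun u u' _ => comb_fun f u * comb_fun g u').

Lemma comb_fun_support f s : (forall u, f u != 0 -> has_composition kappa u) ->
  comb_fun f s != 0 -> forall a, count_mem a s = kappa a.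
Proof.
move=> supp; rewrite /comb_fun; case: insubP => [u _ <-|_]; last by rewrite eqxx.
by move=> /supp/forallP h a; apply/eqP.
Qed.

Lemma marginal_neq0 f (I : seq bool) x :
  marginal (comb_fun f) I x != 0 -> size I = k /\ size x = count id I.
Proof.
move=> m0; have [sI|/negPf sI] := eqVneq (size I) k; last first.
  case/eqP: m0; apply: big1 => u _; rewrite /comb_fun; case: insubP => // w.
  by rewrite size_tuple sI.
split=> //; apply/eqP; apply: contraNT m0 => sx; apply/eqP.
apply: big_pred0 => u; apply: contraNF sx => /eqP <-.
by rewrite size_mask ?size_tuple.
Qed.

(* In a cover of [v] by two words of composition [kappa], the composition of [v] is
   determined by the letters read on the common positions. *)
Definition rest_weight e x : R := \prod_a e a (kappa a + kappa a - count_mem a x)%N.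

Lemma cover_coef_pattern e f g M :
    (forall u, f u != 0 -> has_composition kappa u) ->
    (forall u, g u != 0 -> has_composition kappa u) ->
  cover_coef e f g M = pattern_sum M (fun I J => \sum_(x : (count id I).-tuple 'I_q.+1)
    rest_weight e x * (marginal (comb_fun f) I x * marginal (comb_fun g) J x)).
Proof.
move=> sf sg; rewrite -sum_cover_sum; apply: eq_bigr => v _.
rewrite -cover_sumZ; apply: eq_cover_sum => u u' x c.
have [->|/(comb_fun_support sf) cu] := eqVneq (comb_fun f u) 0; first by rewrite !mul0r !mulr0.
have [->|/(comb_fun_support sg) cu'] := eqVneq (comb_fun g u') 0.
  by rewrite !mulr0.
congr (_ * _); apply: eq_bigr => a _; congr (e a _).
by have := c (pred1 a); rewrite cu cu' => ->; rewrite addnK.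
Qed.

(** Two words of length [k] covering [M] positions share [2k - M < maxn r r'] of them, so the
    marginal of the factor with the larger index vanishes. *)
Lemma cover_coef_eq0 e f g r r' M :
    (r <= k)%N -> (r' <= k)%N -> in_W kappa r f -> in_W kappa r' g ->
    (k + k < M + maxn r r')%N ->
  cover_coef e f g M = 0.
Proof.
move=> rk rk' hf hg hM; rewrite cover_coef_pattern; first last.
- by move=> u; apply: in_W_support hg.
- by move=> u; apply: in_W_support hf.
rewrite -[RHS](pattern_sum0 R M); apply: eq_pattern_sum => I J c s.
apply: big1 => x _.
have [->|mI] := eqVneq (marginal (comb_fun f) I x) 0; first by rewrite mul0r mulr0.
have [->|mJ] := eqVneq (marginal (comb_fun g) J x) 0; first by rewrite !mulr0.
have [/eqP sI _] := marginal_neq0 mI; have [/eqP sJ _] := marginal_neq0 mJ.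
case/orP: (leq_total r r') => rr.
  case/eqP: mJ; apply: (@in_W_marginal0 _ _ _ kappa r' g (Tuple sJ)) => //=.
  by rewrite (eqP sI) (eqP sJ) in s; rewrite -c; lia.
case/eqP: mI; apply: (@in_W_marginal0 _ _ _ kappa r f (Tuple sI)) => //=.
by rewrite (eqP sI) (eqP sJ) in s; lia.
Qed.

(** The overlap is exactly [r], so the coefficient splits over [x] into a positive weight times the
    interleaving form at the marginals. Each form is nonnegative, and one is positive at a nonzero
    marginal. *)
Lemma cover_coef_gt0 e f r M :
    (forall a j, 0 < e a j) -> (r <= k)%N -> in_W kappa r f -> f != 0 ->
    (M + r = k + k)%N ->
  0 < cover_coef e f f M.
Proof.
move=> e0 rk hf f0 Mr.
have sf u : f u != 0 -> has_composition kappa u by apply: in_W_support hf.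
rewrite cover_coef_pattern //.
(* The truncation supplies the support condition of [pattern_sum_ge]; on pairs of masks of size [k]
   in this pattern sum the overlap is [r] anyway. *)
pose phi x (I : seq bool) :=
  if (size I == k) && (count id I == r) then marginal (comb_fun f) I x else 0.
have phi_supp x I : phi x I != 0 -> size I = k /\ count id I = r.
  by rewrite /phi; case: andP => [[/eqP-> /eqP->]|]; rewrite ?eqxx.
have -> : pattern_sum M (fun I J => \sum_(x : (count id I).-tuple 'I_q.+1)
      rest_weight e x * (marginal (comb_fun f) I x * marginal (comb_fun f) J x)) =
    \sum_(x : r.-tuple 'I_q.+1) rest_weight e x * pattern_sum M (fun I J => phi x I * phi x J).
  under eq_bigr => x _ do rewrite -pattern_sumZ.
  rewrite -pattern_sum_sum; apply: eq_pattern_sum => I J c s.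
  have [sI|sI] := eqVneq (size I) k; last first.
    rewrite !big1 // => x _; rewrite /phi ?(negPf sI) ?mul0r ?mulr0 //.
    have [->|/marginal_neq0[/eqP]] := eqVneq (marginal (comb_fun f) I x) 0.
      by rewrite mul0r mulr0.
    by rewrite (negPf sI).
  have [sJ|sJ] := eqVneq (size J) k; last first.
    rewrite !big1 // => x _; rewrite /phi ?(negPf sJ) ?mulr0 //.
    have [->|/marginal_neq0[/eqP]] := eqVneq (marginal (comb_fun f) J x) 0.
      by rewrite !mulr0.
    by rewrite (negPf sJ).
  have cI : count id I = r by lia.
  rewrite cI; apply: eq_bigr => x _.
  by rewrite /phi sI sJ -c cI !eqxx.
have rw0 x : 0 < rest_weight e x by apply: prodr_gt0 => a _; apply: e0.
have [I0 [x0 [cI0 m0]]] := in_W_marginal_neq0 hk rk hf f0.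
have [_ sx0] := marginal_neq0 m0; rewrite cI0 in sx0.
have ge x := pattern_sum_ge I0 (phi_supp x) Mr.
rewrite (bigD1 (Tuple (introT eqP sx0))) //=; apply: ltr_wpDr.
  apply: sumr_ge0 => x _; apply: mulr_ge0; first exact: ltW.
  exact: le_trans (sqr_ge0 _) (ge _).
rewrite mulr_gt0 //; apply: lt_le_trans (ge x0).
by rewrite /phi size_tuple cI0 !eqxx /= exprn_even_gt0.
Qed.

End CoverCoefficients.

(** * Limits *)

Local Open Scope classical_set_scope.
Local Open Scope ring_scope.

Lemma near_eq_cvgr (R : realType) (f g : nat -> R) (l : R) :
  (\forall j \near \oo, f j = g j) -> f j @[j --> \oo] --> l -> g j @[j --> \oo] --> l.
Proof. by move=> fg; apply: cvg_trans; apply: near_eq_cvg. Qed.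

(* The limit of [\prod_x 'C(n_x, kappa_x) / n ^ k]. *)
Definition binomial_limit (R : realType) (q k : nat) (p : 'I_q.+1 -> R)
    (kappa : 'I_q.+1 -> nat) : R :=
  letter_weight (fun x j => p x ^+ j) (alpha_word k kappa)
  / (\prod_x (kappa x)`!)%:R.

Lemma binomial_limit_gt0 (R : realType) (q k : nat) (p : 'I_q.+1 -> R)
    (kappa : 'I_q.+1 -> nat) :
  (forall x, 0 < p x) -> 0 < binomial_limit k p kappa.
Proof.
move=> hp; apply: divr_gt0; last by rewrite ltr0n prodn_gt0 // => x; apply: fact_gt0.
by apply: prodr_gt0 => x _; apply: exprn_gt0.
Qed.

Section Limits.
Variables (R : realType) (q : nat) (n_ : nat -> 'I_q.+1 -> nat) (p : 'I_q.+1 -> R).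
Hypothesis varies : varies_to n_ p.

Local Notation N j := ((weight (n_ j))%:R : R).

Lemma cvg_inv_weight : (N j)^-1 @[j --> \oo] --> (0 : R).
Proof.
have [hw _] := varies; apply/gtr0_cvgV0; last exact/cvgrnyP.
have /cvgnyPge/(_ 1%N) := hw; apply: filterS => j; by rewrite ltr0n.
Qed.

Lemma weight_neq0 : \forall j \near \oo, N j != 0.
Proof.
have [/cvgnyPge/(_ 1%N) hw _] := varies; apply: filterS hw => j.
by rewrite pnatr_eq0 -lt0n.
Qed.

Lemma cvg_expr_inv (d : nat) : (N j)^-1 ^+ d @[j --> \oo] --> ((d == 0%N)%:R : R).
Proof.
case: d => [|d]; first by under eq_cvg do rewrite expr0; apply: cvg_cst.
elim: d => [|d IH]; first exact: cvg_inv_weight.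
under eq_cvg do rewrite exprS.
by have := cvgM cvg_inv_weight IH; rewrite mul0r; apply.
Qed.

Lemma cvg_subn (x : 'I_q.+1) (a : nat) : (n_ j x - a)%:R / N j @[j --> \oo] --> p x.
Proof.
have [_ /(_ x) hx] := varies.
(* Truncated subtraction removes [minn (n_ j x) a], which is bounded by [a] and so negligible
   against [N j]. *)
have h0 : (minn (n_ j x) a)%:R / N j @[j --> \oo] --> (0 : R).
  apply: (@squeeze_cvgr _ _ _ _ (fun=> 0) (fun j => a%:R * (N j)^-1)).
  - apply: nearW => j; rewrite divr_ge0 ?ler0n //=.
    by rewrite ler_wpM2r ?invr_ge0 ?ler0n // ler_nat geq_minr.
  - exact: cvg_cst.
  - by have := cvgM (cvg_cst (a%:R : R)) cvg_inv_weight; rewrite mulr0; apply.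
rewrite -[p x]subr0; apply: near_eq_cvgr (cvgB hx h0).
apply: nearW => j /=; rewrite ?fctE -mulrBl -natrB ?geq_minl //; congr (_%:R / _); lia.
Qed.

Lemma letter_weight_cons (y : 'I_q.+1) (v : seq 'I_q.+1) :
  letter_weight (fun x j => p x ^+ j) (y :: v) = letter_weight (fun x j => p x ^+ j) v * p y.
Proof.
rewrite /letter_weight (bigD1 y) //= [in RHS](bigD1 y) //= eqxx add1n exprSr mulrAC.
by congr (_ * _ * _); apply: eq_bigr => x /negPf xy; rewrite eq_sym xy.
Qed.

Lemma cvg_ffact_word (v : seq 'I_q.+1) :
  (ffact_word (n_ j) v)%:R * (N j)^-1 ^+ size v @[j --> \oo] -->
    letter_weight (fun x j => p x ^+ j) v.
Proof.
elim: v => [|y v IH].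
  rewrite /letter_weight big1 //; apply: cvg_near_cst; apply: nearW => j.
  by rewrite /ffact_word big1 // expr0 mulr1.
rewrite letter_weight_cons; apply: near_eq_cvgr (cvgM IH (@cvg_subn y (count_mem y v))); apply: nearW => j /=.
by rewrite ffact_word_cons natrM exprSr; ring.
Qed.

Variables (k : nat) (kappa : 'I_q.+1 -> nat).
Hypothesis hk : weight kappa = k.

(** As [alpha_word k kappa] has composition [kappa], its falling factorial weight is the product of
    the binomials times the factorials of [kappa]. *)
Lemma cvg_prod_bin :
  (\prod_x 'C(n_ j x, kappa x)%:R) * (N j)^-1 ^+ k @[j --> \oo] --> binomial_limit k p kappa.
Proof.
have := @cvg_ffact_word (alpha_word k kappa); rewrite size_tuple => h.
apply: near_eq_cvgr (cvgM h (cvg_cst ((\prod_x (kappa x)`!)%:R^-1 : R))).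
apply: nearW => j /=; rewrite mulrAC; congr (_ * _).
have f0 : (\prod_x (kappa x)`!)%:R != 0 :> R.
  by rewrite pnatr_eq0 -lt0n prodn_gt0 // => x; apply: fact_gt0.
apply: (mulIf f0); rewrite divfK // -natr_prod -natrM -big_split; congr (_%:R).
by apply: eq_bigr => x _; rewrite /= count_alpha_word // bin_ffact.
Qed.

(** The term of index [M] has order at most [n ^ M] and the squared normalisation has order
    [n ^ (2k)], so the factor [n ^ d] singles out [M = 2k - d], the largest index left by the
    vanishing hypothesis. *)
Lemma cvg_mean_density (f g : comb R q k) (d : nat) :
    (forall x, 0 < p x) -> (d <= k + k)%N ->
    (forall e M, (k + k < M + d)%N -> cover_coef e f g M = 0) ->
  N j ^+ d * mean_uniform (fun w : word q (weight (n_ j)) =>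
      subword_density kappa f w * subword_density kappa g w) @[j --> \oo] -->
    cover_coef (fun x i => p x ^+ i) f g (k + k - d) / (k + k - d)`!%:R / binomial_limit k p kappa ^+ 2.
Proof.
move=> hp dk h0.
set B := binomial_limit k p kappa.
have B0 : 0 < B by apply: binomial_limit_gt0.
pose c j M := cover_coef (fun x i => (n_ j x ^_ i)%:R) f g M.
have cE j M : (\sum_(v : M.-tuple 'I_q.+1) (ffact_word (n_ j) v)%:R
       * cover_sum v (fun u u' _ => comb_fun f u * comb_fun g u')) = c j M.
  by apply: eq_bigr => v _; rewrite natr_prod.
have cc M : c j M * (N j)^-1 ^+ M @[j --> \oo] --> cover_coef (fun x i => p x ^+ i) f g M.
  have -> : (fun j => c j M * (N j)^-1 ^+ M) = (fun j => \sum_(v : M.-tuple 'I_q.+1)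
     ((ffact_word (n_ j) v)%:R * (N j)^-1 ^+ size v)
       * cover_sum v (fun u u' _ => comb_fun f u * comb_fun g u')).
    apply/funext => j; rewrite -cE mulr_suml; apply: eq_bigr => v _.
    by rewrite size_tuple mulrAC.
  apply: cvg_big => [|v _]; first exact: add_continuous.
  by apply: cvgM; [exact: cvg_ffact_word | exact: cvg_cst].
(* The numerator over [N j ^+ (k + k - d)], split so that one factor converges and the other tends
   to 1 for the top index and to 0 for the rest. *)
pose S j := \sum_(M < (k + k - d).+1)
  (c j M * (N j)^-1 ^+ M) * (N j)^-1 ^+ (k + k - d - M) / M`!%:R.
have cS : S j @[j --> \oo] -->
    cover_coef (fun x i => p x ^+ i) f g (k + k - d) / (k + k - d)`!%:R.
  rewrite (_ : _ / _ = \sum_(M < (k + k - d).+1)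
     (cover_coef (fun x i => p x ^+ i) f g M * (k + k - d - M == 0)%N%:R / M`!%:R)).
    apply: cvg_big => [|M _]; first exact: add_continuous.
    apply: cvgM; last exact: cvg_cst.
    by apply: cvgM; [exact: cc | exact: cvg_expr_inv].
  rewrite big_ord_recr /= subnn eqxx mulr1 big1 ?add0r // => M _.
  rewrite (_ : (k + k - d - M == 0)%N = false) ?mulr0 ?mul0r //.
  by have := ltn_ord M; lia.
have B2 : B * B != 0 by rewrite mulf_neq0 // gt_eqF.
apply: near_eq_cvgr (cvgM cS (cvgV B2 (cvgM cvg_prod_bin cvg_prod_bin))).
have [/cvgnyPge/(_ (k + k)%N) hw _] := varies; near=> j.
have Nj0 : N j != 0 by near: j; exact: weight_neq0.
have jw : (k + k <= weight (n_ j))%N by near: j.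
rewrite mean_density (eq_bigr (fun M : 'I__ => c j M / (M`!)%:R)); last first.
  by move=> M _; rewrite cE.
(* Eventually the words have length at least [2k], so the range includes every [M] up to [2k - d];
   larger [M] vanish by [h0]. *)
have -> : \sum_(M < (weight (n_ j)).+1) c j M / M`!%:R =
    \sum_(M < (k + k - d).+1) c j M / M`!%:R.
  rewrite [RHS](big_ord_widen (weight (n_ j)).+1 (fun M => c j M / M`!%:R)); last first.
    by lia.
  rewrite [RHS]big_mkcond; apply: eq_bigr => M _; case: ifPn => // Mk.
  by rewrite /c h0 ?mul0r //; lia.
have NE : (N j)^-1 ^+ (k + k - d) = N j ^+ d * ((N j)^-1 ^+ k * (N j)^-1 ^+ k).
  rewrite -exprD -{2}(subnKC dk) exprD mulrA -exprMn mulfV // expr1n mul1r.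
  by [].
have -> : S j = (\sum_(M < (k + k - d).+1) c j M / M`!%:R) * (N j)^-1 ^+ (k + k - d).
  rewrite /S mulr_suml; apply: eq_bigr => M _.
  have Mk : (M <= k + k - d)%N by rewrite -ltnS.
  have -> : (N j)^-1 ^+ (k + k - d) = (N j)^-1 ^+ M * (N j)^-1 ^+ (k + k - d - M).
    by rewrite -exprD subnKC.
  by ring.
have n0 : (N j)^-1 ^+ k != 0 by rewrite expf_neq0 // invr_eq0.
rewrite NE /=; set A := \sum_(M < _) _; set P := \prod_x _.
(* If some binomial vanishes, the convention that 0 has inverse 0 makes both sides 0. *)
have [P0|P0] := eqVneq P 0.
  by rewrite P0 !mul0r expr0n invr0 !mulr0.
by field; rewrite P0 n0.
Unshelve. all: by end_near.
Qed.

End Limits.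

(** * Half-integer scaling and conclusion *)

Lemma mean_uniform_scale (R : realType) (q : nat) (c : 'I_q.+1 -> nat) (a b : R)
    (F G : word q (weight c) -> R) :
  mean_uniform (fun w => (a * F w) * (b * G w)) =
  a * b * mean_uniform (fun w => F w * G w).
Proof.
rewrite /mean_uniform mulrA mulr_sumr; congr (_ / _).
by apply: eq_bigr => w _; rewrite mulrACA.
Qed.

(** Compares the scaling by half powers with the integer power [N ^+ d]. For [d = maxn r s] the
    leftover exponent is the distance between [r] and [s]. *)
Lemma powR_half_mul (R : realType) (N : R) (r s d : nat) :
    0 < N -> (r + s <= d + d)%N ->
  N `^ (r%:R / 2) * N `^ (s%:R / 2) = N ^+ d * Num.sqrt N^-1 ^+ (d + d - (r + s)).
Proof.
move=> N0 rsd; have u0 : 0 < Num.sqrt N by rewrite sqrtr_gt0.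
have E i : N `^ (i%:R / 2) = Num.sqrt N ^+ i.
  by rewrite mulrC powRrM powR12_sqrt ?ltW // powR_mulrn // ltW.
have -> : N ^+ d = Num.sqrt N ^+ (r + s) * Num.sqrt N ^+ (d + d - (r + s)).
  by rewrite -exprD subnKC // addnn -mul2n exprM sqr_sqrtr // ltW.
by rewrite !E -[LHS]exprD sqrtrV ?ltW // -mulrA -exprMn mulfV ?gt_eqF // expr1n mulr1.
Qed.

Theorem theorem3 (R : realType) (q : nat) (hq : (2 <= q.+1)%N)
    (k : nat) (kappa : 'I_q.+1 -> nat)
    (hpart : partition_composition kappa) (hpos : forall x, (0 < kappa x)%N)
    (hk : weight kappa = k)
    (r : nat) (hr : (r <= k - kappa ord0)%N)
    (f : comb R q k) (hf : in_W kappa r f) (hf0 : f != 0)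
    (p : 'I_q.+1 -> R) (hp : forall x, 0 < p x) :
  (exists2 C : R, 0 < C &
     forall n_ : nat -> 'I_q.+1 -> nat, varies_to n_ p ->
       (weight (n_ j))%:R ^+ r
         * mean_uniform (fun w : word q (weight (n_ j)) => (subword_density kappa f w) ^+ 2)
         @[j --> \oo] --> C)
  /\
  (forall (r' : nat) (f' : comb R q k),
     (r' <= k - kappa ord0)%N -> r' <> r -> in_W kappa r' f' ->
     forall n_ : nat -> 'I_q.+1 -> nat, varies_to n_ p ->
       mean_uniform (fun w : word q (weight (n_ j)) =>
           ((weight (n_ j))%:R `^ (r%:R / 2) * subword_density kappa f w)
           * ((weight (n_ j))%:R `^ (r'%:R / 2) * subword_density kappa f' w))
         @[j --> \oo] --> (0 : R)).
Proof.
have rk : (r <= k)%N := leq_trans hr (leq_subr _ _).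
have rkk : (r <= k + k)%N by rewrite (leq_trans rk) // leq_addr.
split.
  (* The leading coefficient, at [M = 2k - r], with its normalisation; it involves only [f], [kappa]
     and [p], so it serves all sequences [n_]. *)
  exists (cover_coef (fun x i => p x ^+ i) f f (k + k - r) / (k + k - r)`!%:R
      / binomial_limit k p kappa ^+ 2).
    rewrite !divr_gt0 ?ltr0n ?fact_gt0 ?exprn_gt0 ?binomial_limit_gt0 //.
    apply: (cover_coef_gt0 hk _ rk hf hf0); last by rewrite subnK.
    by move=> a j; apply: exprn_gt0.
  move=> n_ hn; apply: (cvg_mean_density hn hk hp rkk) => e M hM.
  by apply: (cover_coef_eq0 hk e rk rk hf hf); rewrite maxnn.
move=> r' f' hr' rr' hf' n_ hn.
have rk' : (r' <= k)%N := leq_trans hr' (leq_subr _ _).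
(* The mean already converges when scaled by the power [d]. The half powers give strictly less,
   since [r'] differs from [r], and the missing factor [eps] tends to 0. *)
pose d := maxn r r'.
have dk : (d <= k + k)%N by rewrite /d; lia.
have lim : ((weight (n_ j))%:R : R) ^+ d * mean_uniform (fun w : word q (weight (n_ j)) =>
    subword_density kappa f w * subword_density kappa f' w) @[j --> \oo] -->
    cover_coef (fun x i => p x ^+ i) f f' (k + k - d) / (k + k - d)`!%:R
      / binomial_limit k p kappa ^+ 2.
  apply: (cvg_mean_density hn hk hp dk) => e M hM.
  exact: (cover_coef_eq0 hk e rk rk' hf hf').
have eps : Num.sqrt ((weight (n_ j))%:R : R)^-1 ^+ (d + d - (r + r')) @[j --> \oo]
    --> (0 : R).
  have [l1 l2] := (@sqrt_continuous R 0, @exprn_continuous R (d + d - (r + r')) (Num.sqrt 0)).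
  have := continuous_cvg eventually_filter l2
            (continuous_cvg eventually_filter l1 (cvg_inv_weight hn)).
  rewrite sqrtr0 expr0n (_ : (_ == 0)%N = false); last by apply/eqP; rewrite /d; lia.
  exact.
have := @cvgM _ _ _ eventually_filter _ _ _ _ eps lim; rewrite mul0r; apply: near_eq_cvgr.
have [/cvgnyPge/(_ 1%N) hw _] := hn; apply: filterS hw => j hj /=.
rewrite mean_uniform_scale (@powR_half_mul _ _ _ _ d) ?ltr0n //; last by rewrite /d; lia.
by rewrite [in RHS]mulrAC mulrC mulrA.
Qed.
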